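(* Let $(T_n)_{n\in\mathbb{N}}$ be an $\mathbb{N}$-indexed family of uniformly continuously searchable closeness spaces, with closeness functions $c_n : T_n \to T_n \to \mathbb{N}_\infty$. Then the product type $\prod_{n\in\mathbb{N}} T_n$, equipped with the countable product closeness function $c_{\Pi T}$, is a uniformly continuously searchable closeness space.
   Context: We work in constructive Martin-Löf type theory with function extensionality and propositional extensionality assumed; ''there is'' means an explicit witness is constructed. $\mathbb{N}_\infty$ is the type of decreasing binary sequences $u:\mathbb{N}\to\{0,1\}$ (with $u_i\ge u_{i+1}$ for all $i$). For $n\in\mathbb{N}$, $\underline{n}\in\mathbb{N}_\infty$ is the sequence of $n$ ones followed by zeros, and $\infty$ is the constant sequence $1$. Write $u\preceq v$ iff for all $n$, $u_n=1$ implies $v_n=1$, and $\min(u,v)$ for the pointwise minimum. A closeness space is a type $X$ with $c:X\to X\to\mathbb{N}_\infty$ such that (i) $c(x,y)=\infty$ iff $x=y$, (ii) $c(x,y)=c(y,x)$, (iii) $\min(c(x,y),c(y,z))\preceq c(x,z)$. For $\varepsilon\in\mathbb{N}$, $x,y$ are $\varepsilon$-close, written $C_\varepsilon(x,y)$, iff $\underline{\varepsilon}\preceq c(x,y)$. A predicate $p$ on $X$ (proposition-valued) is decidable if for every $x$ we can decide $p(x)$ or $\neg p(x)$; it is uniformly continuous if there is $\delta\in\mathbb{N}$ (its modulus) such that $C_\delta(x_1,x_2)$ implies $p(x_1)\Leftrightarrow p(x_2)$. A closeness space $K$ is uniformly continuously searchable if for every decidable predicate $p$ on $K$ given together with a modulus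 of uniform continuity, there is $k_0\in K$ such that if some $k\in K$ satisfies $p(k)$ then $p(k_0)$. The countable product closeness function on $\prod_n T_n$ is defined recursively by $c_{\Pi T}(\alpha,\beta)_0 := c_0(\alpha_0,\beta_0)_0$ and $c_{\Pi T}(\alpha,\beta)_{m+1} := \min\big(c_0(\alpha_0,\beta_0)_{m+1},\ c_{\Pi(\mathrm{tail}\,T)}(\mathrm{tail}\,\alpha,\mathrm{tail}\,\beta)_m\big)$, where $\mathrm{tail}\,T = (T_{n+1})_n$ with closeness functions $(c_{n+1})_n$ and $\mathrm{tail}\,\alpha = (\alpha_{n+1})_n$ (equivalently $c_{\Pi T}(\alpha,\beta)_m=\min_{i\le m} c_i(\alpha_i,\beta_i)_{m-i}$). *)

(* Defs.v *)
From mathcomp Require Import all_boot.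

Set Implicit Arguments.
Unset Strict Implicit.
Unset Printing Implicit Defensive.

(* Decreasing binary sequences; the order is that of nat through the coercion
   bool >-> nat. *)
Record Ninf := MkNinf {
  ninf_seq :> nat -> bool;
  ninf_decr : forall i, ninf_seq i.+1 <= ninf_seq i
}.

Lemma ninf_nat_decr (n i : nat) : (i.+1 < n) <= (i < n).
Proof. by case: (ltnP i.+1 n) => // /ltnW ->. Qed.

Definition ninf_nat (n : nat) : Ninf := MkNinf (ninf_nat_decr n).

Definition ninf_infty : Ninf := @MkNinf (fun=> true) (fun=> leqnn 1).

Definition ninf_le (u v : Ninf) : Prop := forall n, u n = true -> v n = true.

Lemma leq_andb (a b c d : bool) : a <= b -> c <= d -> (a && c) <= (b && d).
Proof. by case: a; case: b; case: c; case: d. Qed.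

Lemma ninf_min_decr (u v : Ninf) (i : nat) :
  (u i.+1 && v i.+1) <= (u i && v i).
Proof. exact: leq_andb (ninf_decr u i) (ninf_decr v i). Qed.

Definition ninf_min (u v : Ninf) : Ninf := MkNinf (ninf_min_decr u v).

Record is_closeness (X : Type) (c : X -> X -> Ninf) : Prop := IsCloseness {
  closeness_infty : forall x y, c x y = ninf_infty <-> x = y;
  closeness_sym : forall x y, c x y = c y x;
  closeness_ultra : forall x y z,
    ninf_le (ninf_min (c x y) (c y z)) (c x z)
}.

Record closenessSpace := ClosenessSpace {
  carrier :> Type;
  closeness : carrier -> carrier -> Ninf;
  closenessP : is_closeness closeness
}.
Arguments closeness : clear implicits.
Arguments ClosenessSpace [carrier closeness].

Definition close (X : closenessSpace) (e : nat) (x y : X) : Prop :=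
  ninf_le (ninf_nat e) (closeness X x y).

Definition is_modulus (X : closenessSpace) (p : X -> Prop) (d : nat) : Prop :=
  forall x1 x2, close d x1 x2 -> (p x1 <-> p x2).

(* Valued in Type: a searcher computes the witness k0 from the decision
   procedure of p and the modulus d. *)
Definition uc_searchable (K : closenessSpace) : Type :=
  forall p : K -> Prop, (forall x, decidable (p x)) ->
  forall d : nat, is_modulus p d ->
  {k0 : K | (exists k, p k) -> p k0}.

Definition tail (T : nat -> Type) (a : forall n, T n) : forall n, T n.+1 :=
  fun n => a n.+1.

Fixpoint prod_closeness_seq (T : nat -> Type)
    (c : forall n, T n -> T n -> Ninf) (a b : forall n, T n) (m : nat) : bool :=
  match m with
  | 0 => c 0 (a 0) (b 0) 0
  | m'.+1 => c 0 (a 0) (b 0) m'.+1 &&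
      @prod_closeness_seq (fun n => T n.+1) (tail c) (tail a) (tail b) m'
  end.

Lemma prod_closeness_decr (T : nat -> Type) (c : forall n, T n -> T n -> Ninf)
    (a b : forall n, T n) (i : nat) :
  prod_closeness_seq c a b i.+1 <= prod_closeness_seq c a b i.
Proof.
elim: i T c a b => [|i IH] T c a b.
  rewrite -[X in _ <= nat_of_bool X]andbT.
  exact: leq_andb (ninf_decr _ 0) (leq_b1 _ : nat_of_bool _ <= true).
exact: leq_andb (ninf_decr _ i.+1) (IH (fun n => T n.+1) _ _ _).
Qed.

Definition prod_closeness (T : nat -> Type) (c : forall n, T n -> T n -> Ninf)
    (a b : forall n, T n) : Ninf :=
  MkNinf (prod_closeness_decr c a b).

(* Main.v *)
(* The searcher for the product is built by induction on the modulus.  A predicate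
   of modulus 0 is constant, so any point will do.  If p has modulus d + 1 then,
   for each x in T_0, the predicate b |-> p (x :: b) has modulus d on the tail
   product, and the inductive searcher returns some k x.  The predicate
   x |-> p (x :: k x) on T_0 is equivalent to x |-> exists b, p (x :: b); hence,
   although k need not respect closeness, it has modulus d + 1 and T_0 can be
   searched for it. *)
Require Import Defs.
From mathcomp Require Import all_boot.
From Stdlib Require Import FunctionalExtensionality.

(** Monotonicity proofs are equalities between booleans, hence unique, so only the bits matter. *)
Lemma ninf_ext (u v : Ninf) : (forall n, u n = v n) -> u = v.
Proof.
case: u v => u hu [v hv] /= /functional_extensionality uv.
case: v / uv hv => hv; congr MkNinf.
by apply: functional_extensionality_dep => i; apply: bool_irrelevance.
Qed.

Lemma ninf_eq_infty (u : Ninf) : u = ninf_infty <-> forall n, u n.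
Proof. by split=> [-> //|u1]; apply: ninf_ext. Qed.

Lemma closeness_refl (X : closenessSpace) (x : X) n : closeness X x x n.
Proof. by move: n; apply/ninf_eq_infty/(closeness_infty (closenessP X)). Qed.

(** Unfolding the recursion yields a minimum over an antidiagonal; in this form each closeness axiom
    reduces to that of the factors. *)
Lemma prod_closenessP (T : nat -> Type) (c : forall n, T n -> T n -> Ninf)
    (a b : forall n, T n) m :
  prod_closeness c a b m <-> forall i j, i + j = m -> c i (a i) (b i) j.
Proof.
elim: m T c a b => [|m IH] T c a b /=.
  split=> [ab i j|]; last exact.
  by case: i => // /[!add0n] ->.
rewrite -/(is_true _); split=> [/andP[ab0 abS] [|i] j|ab].
- by rewrite add0n => ->.
- by rewrite addSn => -[]; apply: (IH _ _ _ _).1 abS i j.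
- apply/andP; split; first exact: ab.
  by apply/(IH (fun n => T n.+1)) => i j ijm; apply: (ab i.+1); rewrite addSn ijm.
Qed.

Lemma prod_is_closeness (T : nat -> closenessSpace) :
  is_closeness (prod_closeness (fun n => closeness (T n))).
Proof.
split=> [a b|a b|a b e m].
- split=> [/ninf_eq_infty ab|->].
    apply: functional_extensionality_dep => i.
    apply/(closeness_infty (closenessP (T i)))/ninf_eq_infty => j.
    exact: (prod_closenessP _ _ _ _ _).1 (ab (i + j)) i j erefl.
  apply/ninf_eq_infty => m; apply/prod_closenessP => i j _.
  exact: closeness_refl.
- apply: ninf_ext => m; apply/idP/idP => /prod_closenessP ab;
    apply/prod_closenessP => i j ijm;
    by rewrite (closeness_sym (closenessP (T i))); apply: ab.
- move=> /andP[/prod_closenessP ab /prod_closenessP be].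
  apply/prod_closenessP => i j ijm.
  apply: (closeness_ultra (closenessP (T i)) (y := b i)).
  by rewrite /= ab ?be.
Qed.

Definition prodSpace (T : nat -> closenessSpace) : closenessSpace :=
  ClosenessSpace (prod_is_closeness T).

Lemma prod_closeP (T : nat -> closenessSpace) e (a b : prodSpace T) :
  close e a b <-> forall i j, i + j < e -> closeness (T i) (a i) (b i) j.
Proof.
split=> [ab i j ije|ab m me].
  exact: (prod_closenessP _ _ _ _ _).1 (ab _ ije) i j erefl.
by apply/prod_closenessP => i j ijm; apply: ab; rewrite ijm.
Qed.

Definition scons {T : nat -> Type} (x : T 0) (b : forall n, T n.+1) :
    forall n, T n :=
  fun n => match n with 0 => x | n'.+1 => b n' end.

Lemma scons_head_tail (T : nat -> Type) (a : forall n, T n) :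
  scons (a 0) (tail a) = a.
Proof. by apply: functional_extensionality_dep => -[]. Qed.

Lemma close_scons_head (T : nat -> closenessSpace) e (x y : T 0)
    (b : prodSpace (fun n => T n.+1)) :
  close e x y -> close (X := prodSpace T) e (scons x b) (scons y b).
Proof.
move=> xy; apply/prod_closeP => -[|i] j ije; first exact: xy.
exact: closeness_refl.
Qed.

(** Prepending a common head moves coordinate [i] to [i.+1], and the bound [i + j < e] turns this
    shift into one more unit of precision. *)
Lemma close_scons_tail (T : nat -> closenessSpace) e (x : T 0)
    (a b : prodSpace (fun n => T n.+1)) :
  close e a b -> close (X := prodSpace T) e.+1 (scons x a) (scons x b).
Proof.
move=> /prod_closeP ab; apply/prod_closeP => -[|i] j ije.
  exact: closeness_refl.
exact: ab.
Qed.

(** A searcher returns a point even when no witness is known; the constant predicate [True] suffices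
    to extract one. *)
Lemma uc_searchable_point (K : closenessSpace) : uc_searchable K -> K.
Proof.
move=> hK; have pdec (x : K) : decidable True by left.
by have [//|x _] := hK (fun=> True) pdec 0.
Qed.

Lemma prod_uc_searchable (T : nat -> closenessSpace) :
  (forall n, uc_searchable (T n)) -> uc_searchable (prodSpace T).
Proof.
(* [T] stays general because the inductive step uses the shifted family. *)
move=> hT p pdec d; elim: d T hT p pdec => [|d IH] T hT p pdec pd.
  exists (fun n => uc_searchable_point _ (hT n)) => -[k pk].
  by apply: (pd k _ _).1 pk.
have tail_search (x : T 0) : {k : prodSpace (fun n => T n.+1) |
    (exists b, p (scons x b)) -> p (scons x k)}.
  apply: (IH _ (fun n => hT n.+1) (fun b => p (scons x b))) => [b|a b ab].
    exact: pdec.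
  exact: pd (close_scons_tail _ _ _ _ _ ab).
pose k x := sval (tail_search x).
have kP x b : p (scons x b) -> p (scons x (k x)).
  by move=> pb; apply: (svalP (tail_search x)); exists b.
have [x y xy|x0 x0P] :=
    hT 0 (fun x => p (scons x (k x))) (fun x => pdec _) d.+1.
  (* With the tail fixed, [x] can be exchanged for [y]: [k x] is then a valid tail for [y], so by
     [kP] the tail [k y] is one too, however far it is from [k x]. *)
  have pxy b := pd _ _ (close_scons_head _ _ _ _ b xy).
  by split=> pk; [apply: kP ((pxy _).1 pk) | apply: kP ((pxy _).2 pk)].
exists (scons x0 (k x0)) => -[a pa]; apply: x0P; exists (a 0).
by apply: (kP _ (tail a)); rewrite scons_head_tail.
Qed.

Theorem theorem3p96 (T : nat -> closenessSpace)
    (hT : forall n, uc_searchable (T n)) :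
  {H : is_closeness (prod_closeness (fun n => closeness (T n)))
     & uc_searchable (ClosenessSpace H)}.
Proof. by exists (prod_is_closeness T); apply: prod_uc_searchable. Qed.
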